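(* Let $m=2d+4$. If $d=4$, then $\gamma^d_m(K^d)=\frac{2d-3}{2d-1}$ (that is, $\gamma^4_{12}(K^4)=\frac57$). If $d\ge 5$, then $\gamma^d_m(K^d)\le\frac{2d-3}{2d-1}$.
   Context: $K^d=\{(x_1,\ldots,x_d)\in\mathbb{R}^d : |x_1|+\cdots+|x_d|\le 1\}$ is the $d$-dimensional crosspolytope. For a convex body $K\subset\mathbb{R}^d$ with non-empty interior and a positive integer $m$, $$\gamma^d_m(K)=\min\Big\{\lambda>0 : \exists\, u_1,\ldots,u_m\in\mathbb{R}^d \text{ such that } K\subseteq\bigcup_{i=1}^m(\lambda K+u_i)\Big\},$$ i.e. the smallest positive $\lambda$ such that $K$ can be covered by $m$ translates of $\lambda K$. *)

(* Defs.v *)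
From HB Require Import structures.
From mathcomp Require Import all_boot all_order all_algebra.
From mathcomp Require Import all_classical all_reals all_analysis.

Set Implicit Arguments.
Unset Strict Implicit.
Unset Printing Implicit Defensive.

Import Order.TTheory GRing.Theory Num.Theory numFieldNormedType.Exports.
Local Open Scope classical_set_scope.
Local Open Scope ring_scope.

Definition crosspolytope (R : realType) (d : nat) : set 'rV[R]_d :=
  [set x | \sum_(i < d) `|x 0 i| <= 1].

Definition covering_ratios (R : realType) (d m : nat) (K : set 'rV[R]_d) :
    set R :=
  [set lambda | 0 < lambda /\ exists u : 'I_m -> 'rV[R]_d,
    K `<=` \bigcup_i [set lambda *: y + u i | y in K]].

(* The infimum is a minimum whenever K is compact with non-empty interior
   (and d, m > 0): see gamma_is_min below. *)
Definition gamma (R : realType) (d m : nat) (K : set 'rV[R]_d) : R :=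
  inf (covering_ratios m K).

Lemma covering_ratios_neq0 (R : realType) (d m : nat) (K : set 'rV[R]_d) :
  (0 < m)%N -> covering_ratios m K !=set0.
Proof.
move=> m_gt0; exists 1; split=> //; exists (fun=> 0) => x Kx.
by exists (Ordinal m_gt0) => //; exists x => //; rewrite scale1r addr0.
Qed.

Lemma covering_ratios_lb (R : realType) (d m : nat) (K : set 'rV[R]_d) :
  lbound (covering_ratios m K) 0.
Proof. by move=> l [/ltW]. Qed.

Lemma ultra_fmap (T U : Type) (f : T -> U) (G : set_system T) :
  UltraFilter G -> UltraFilter (f @ G).
Proof.
move=> UG; split; first exact: fmap_proper_filter.
move=> H PH GH; apply/seteqP; split; last exact: GH.
move=> A HA; have [//|GnA] := in_ultra_setVsetC (f @^-1` A) UG.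
have HnA : H (~` A) by exact: GH.
have [z []//] : A `&` ~` A !=set0.
by apply: (@filter_ex _ H); apply: filterI.
Qed.

Lemma gamma_cover (R : realType) (d m : nat) (K : set 'rV[R]_d) :
    (0 < m)%N -> compact K ->
  exists u : 'I_m -> 'rV[R]_d,
    K `<=` \bigcup_i [set gamma m K *: y + u i | y in K].
Proof.
move=> m0 cK; set g := gamma m K; set S := covering_ratios m K.
have S0 : S !=set0 by exact: covering_ratios_neq0.
have hlS : has_lbound S by exists 0; exact: covering_ratios_lb.
have near_g (e : R) : 0 < e -> exists2 l, S l & l < g + e.
  by move=> e0; have [l Sl ?] := inf_adherent e0 (conj S0 hlS); exists l.
have ge_g l : S l -> g <= l by exact: ge_inf.
have PF : ProperFilter (within S (nbhs g)).
  apply: Build_ProperFilter_ex => A [e /= e0 Ae].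
  have [l Sl lt_l] := near_g _ e0.
  exists l; apply: Ae => //=; rewrite distrC ger0_norm ?subr_ge0 ?ge_g//.
  by rewrite ltrBlDl.
have [G [UG FG]] := ultraFilterLemma PF.
have GS : G S by apply: FG; exact: withinT.
have Gg : G --> g.
  by move=> A gA; apply: FG; rewrite /within/=; near=> l => _; near: l.
have cover l : exists v : 'I_m -> 'rV[R]_d, S l ->
    K `<=` \bigcup_i [set l *: y + v i | y in K].
  have [[_ [v Kv]]|nSl] := pselect (S l); first by exists v.
  by exists (fun=> 0).
have [v vP] := choice cover.
exists (fun i => lim ((fun l => v l i) @ G)) => x Kx.
have [i Gi] : exists i : 'I_m, G [set l | exists2 y, K y & l *: y + v l i = x].
  apply: contrapT => /forallNP nG.
  have GC : G [set l | forall i : 'I_m,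
      ~ exists2 y, K y & l *: y + v l i = x].
    apply: filter_forall => i.
    by have [/nG//|] := in_ultra_setVsetC
      [set l | exists2 y, K y & l *: y + v l i = x] UG.
  have [l [Sl]] := @filter_ex _ G _ _ (filterI GS GC).
  by have [j _ [y Ky yx]] := vP l Sl x Kx; move/(_ j); apply; exists y.
have sel l : exists y, (exists2 y, K y & l *: y + v l i = x) ->
    K y /\ l *: y + v l i = x.
  have [[y Ky yx]|nx] := pselect (exists2 y, K y & l *: y + v l i = x).
    by exists y.
  by exists 0.
have [y yP] := choice sel.
have Uy : UltraFilter (y @ G) by exact: ultra_fmap.
have [p [Kp yp]] : K `&` [set p | y @ G --> p] !=set0.
  move: cK; rewrite compact_ultra; apply => //.
  change (G (y @^-1` K)).
  by apply: (@filterS _ G) Gi => l /yP[].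
exists i => //; exists p => //.
have ly : (fun l : R => x - l *: y l) @ G --> x - g *: p.
  by apply: cvgB; [exact: cvg_cst|exact: cvgZ].
have -> : lim ((fun l => v l i) @ G) = x - g *: p.
  apply: cvg_lim => //; apply: cvg_trans ly.
  apply: near_eq_cvg; apply: filterS Gi => l /yP[_ <-].
  by rewrite addrC addKr.
by rewrite addrC subrK.
Unshelve. all: by end_near. Qed.

Lemma gamma_is_min (R : realType) (d m : nat) (K : set 'rV[R]_d) :
    (0 < d)%N -> (0 < m)%N -> compact K -> K° !=set0 ->
  covering_ratios m K (gamma m K) /\
  lbound (covering_ratios m K) (gamma m K).
Proof.
move=> d0 m0 cK [x Kx]; split; last first.
  by apply: ge_inf; exists 0; exact: covering_ratios_lb.
have [u Ku] := gamma_cover m0 cK.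
split; last by exists u.
rewrite lt_neqAle lb_le_inf ?andbT; [|exact: covering_ratios_neq0|
  exact: covering_ratios_lb].
apply/negP => /eqP g0.
have fK : finite_set K.
  apply: (@sub_finite_set _ _ [set u i | i in [set: 'I_m]]) => [z /Ku|].
    by case=> i _ [y _]; rewrite -g0 scale0r add0r => <-; exists i.
  exact/finite_image/finite_finset.
pose e : 'rV[R]_d := const_mx 1.
have e0 : e != 0.
  apply/eqP => /rowP /(_ (Ordinal d0)); rewrite !mxE.
  by move/eqP; rewrite oner_eq0.
have : (fun t : R => x + t *: e) @ (0 : R) --> x + 0 *: e.
  by apply: cvgD; [exact: cvg_cst|apply: cvgZr_tmp; exact: cvg_id].
rewrite scale0r addr0 => /(_ _ Kx) [r /= r0 rK].
pose f (n : nat) := x + (r / n.+2%:R) *: e.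
have inj_f : injective f.
  move=> a b /addrI /eqP; rewrite -subr_eq0 -scalerBl scaler_eq0.
  rewrite (negPf e0) orbF -mulrBr mulf_eq0 (gt_eqF r0)/= subr_eq0.
  by move=> /eqP/invr_inj/eqP; rewrite eqr_nat => /eqP[].
have fKf : f @^-1` K = [set: nat].
  apply/seteqP; split=> // n _; apply: rK => /=.
  rewrite sub0r normrN gtr0_norm ?divr_gt0//.
  by rewrite ltr_pdivrMr// ltr_pMr// ltr1n.
have := finite_preimage (in2W inj_f) fK; rewrite fKf.
exact: infinite_nat.
Qed.

Lemma l1_norm_continuous (R : realType) (d : nat) :
  continuous (fun x : 'rV[R]_d => \sum_(i < d) `|x 0 i|).
Proof.
apply: (continuous_big (op := +%R) (x0 := 0)) => [|i _ x].
  exact: add_continuous.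
apply: (@continuous_comp _ _ _ (fun y : 'rV[R]_d => y 0 i) (@Num.norm R R)).
  exact: coord_continuous.
exact: norm_continuous.
Qed.

Lemma crosspolytope_compact (R : realType) (d : nat) :
  compact (@crosspolytope R d).
Proof.
apply: bounded_closed_compact.
  exists 1; split=> // M M1 x xK.
  change (mx_norm x <= M); rewrite mx_normrE; apply: bigmax_le => [|[i j] _ /=].
    by rewrite ltW// (lt_trans _ M1).
  rewrite (le_trans _ (ltW M1))// (le_trans _ xK)// ord1.
  by rewrite (bigD1 j)//= lerDl sumr_ge0.
by apply: (preimage_closed _ (@closed_le R 1)) => x _; exact: l1_norm_continuous.
Qed.

Lemma crosspolytope_interior (R : realType) (d : nat) :
  (@crosspolytope R d)° !=set0.
Proof.
exists 0.
have lt1 : \sum_(i < d) `|(0 : 'rV[R]_d) 0 i| < 1.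
  by rewrite big1 => [|i _]; [exact: ltr01|rewrite mxE normr0].
have := @l1_norm_continuous R d 0 _ (lt_nbhsl lt1).
by apply: (@filterS _ (nbhs (0 : 'rV[R]_d)) _) => x /ltW.
Qed.

Lemma gamma_crosspolytope_is_min (R : realType) (d m : nat) :
    (0 < d)%N -> (0 < m)%N ->
  covering_ratios m (@crosspolytope R d) (gamma m (@crosspolytope R d)) /\
  lbound (covering_ratios m (@crosspolytope R d))
    (gamma m (@crosspolytope R d)).
Proof.
move=> d0 m0; apply: gamma_is_min => //.
- exact: crosspolytope_compact.
- exact: crosspolytope_interior.
Qed.

(* Main.v *)
Require Import Defs.
From mathcomp Require Import all_boot all_order all_algebra.
From mathcomp Require Import all_classical all_reals all_analysis.
From mathcomp Require Import ring lra.

(** Put [t = 2 / (2 d - 1)], so that the ratio of the theorem is [1 - t].  A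
    translate [r K + u] of the crosspolytope [K] is the set of the [x] with
    [l1norm (x - u) <= r] ([mem_crosspolytope_translate]), so everything is
    about distances in the l1 norm.

    Upper bound.  When [0 <= u_j <= x_j] in every coordinate, up to the sign of
    [x_j], subtracting [u] from [x] lowers the l1 norm by exactly that of [u].
    So a unit vector [x] lies in the translate centred at [u] as soon as [u]
    has norm [t] and is dominated by [x] in this sense.  The [2 d] centres
    [+-t e_i] take care of every [x] with a coordinate of size at least [t].
    In all other cases no coordinate can be smaller than [t / 2] in size, since
    the others add up to at most [(d - 1) t = 1 - t / 2]; so [x] dominates one
    of the four centres [(+-t/2, +-t/2, 0, ..., 0)].  These are [2 d + 4]
    centres ([sphere_covered]).  As all of them have norm at most [1 - t], every
    translate contains the origin, hence by convexity the segments from the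
    origin to the points of the sphere that it covers, and the whole of [K] is
    covered ([covering_ratio_of_sphere]).

    Lower bound for [d = 4].  Two points in one translate of [r K] with
    [r < 5 / 7] are at distance less than [10 / 7].  Among the points of [K]
    with coordinates in [Z / 7] consider the eight vertices and the signed
    permutations of [(2, 2, 2, 1) / 7].  The vertices are at distance at least
    [10 / 7] from each other and from all the rest, so they use up eight of the
    twelve translates.  For the rest, the distance of [x] and [y] is [2] minus
    twice the sum of [min |x_i| |y_i|] over the coordinates in which their signs
    agree.  Hence two of them are too far apart when their signs differ in three
    places, and also when they differ in two places and, in the two others, one
    point has its small entry in the first and the other in the second.  This
    leaves so little room that four translates do not suffice: fourteen of these
    64 points already cannot be distributed over four classes of diameter less
    than [10 / 7].  The attempts to distribute them form a tree with a few dozen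
    nodes, which is explored by computation ([no_small_partition]); that the
    exploration misses no distribution is [near_partitions_neq0]. *)

Set Implicit Arguments.
Unset Strict Implicit.
Unset Printing Implicit Defensive.

Import Order.TTheory GRing.Theory Num.Theory.
Local Open Scope classical_set_scope.
Local Open Scope ring_scope.

(** * The l1 norm and translates of the crosspolytope *)

Section L1Norm.
Variables (R : realType) (d : nat).
Implicit Types x y z u : 'rV[R]_d.

Definition l1norm x : R := \sum_(i < d) `|x 0 i|.

Lemma l1norm_ge0 x : 0 <= l1norm x.
Proof. by apply: sumr_ge0 => i _. Qed.

Lemma l1normD x y : l1norm (x + y) <= l1norm x + l1norm y.
Proof.
by rewrite /l1norm -big_split; apply: ler_sum => i _; rewrite mxE ler_normD.
Qed.

Lemma l1normZ (a : R) x : l1norm (a *: x) = `|a| * l1norm x.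
Proof.
by rewrite /l1norm mulr_sumr; apply: eq_bigr => i _; rewrite mxE normrM.
Qed.

Lemma l1normN x : l1norm (- x) = l1norm x.
Proof. by rewrite -scaleN1r l1normZ normrN1 mul1r. Qed.

Lemma l1norm_eq0 x : (l1norm x == 0) = (x == 0).
Proof.
apply/idP/eqP => [|->]; last by rewrite -(scale0r 0) l1normZ normr0 mul0r.
rewrite psumr_eq0 // => /allP x0; apply/rowP => i; rewrite mxE.
by apply/eqP; rewrite -normr_eq0; exact: x0.
Qed.

Lemma l1dist_triangle u x y : l1norm (x - y) <= l1norm (x - u) + l1norm (y - u).
Proof.
have -> : x - y = (x - u) + - (y - u) by rewrite opprB addrA subrK.
by apply: le_trans (l1normD _ _) _; rewrite l1normN.
Qed.

Lemma l1norm_shrink x u :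
    (forall i, `|x 0 i - u 0 i| = `|x 0 i| - `|u 0 i|) ->
  l1norm (x - u) = l1norm x - l1norm u.
Proof.
by move=> xu; rewrite /l1norm -sumrB; apply: eq_bigr => i _; rewrite !mxE xu.
Qed.

Lemma mem_crosspolytope_translate (r : R) x u : 0 < r ->
  (exists2 y, crosspolytope y & r *: y + u = x) <-> l1norm (x - u) <= r.
Proof.
move=> r0; split=> [[y Ky <-]|xu].
  rewrite addrK l1normZ gtr0_norm // ler_piMr //; exact: ltW.
exists (r^-1 *: (x - u)); last by rewrite scalerA divff ?gt_eqF// scale1r subrK.
change (l1norm (r^-1 *: (x - u)) <= 1).
by rewrite l1normZ gtr0_norm ?invr_gt0// ler_pdivrMl// mulr1.
Qed.

(** Each translate is convex and contains the origin, so together with a point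
    of the unit sphere it contains the radius that ends there. *)
Lemma covering_ratio_of_sphere (I : finType) (i0 : I) (v : I -> 'rV[R]_d)
    (r : R) : 0 < r ->
    (forall i, l1norm (v i) <= r) ->
    (forall x, l1norm x = 1 -> exists i, l1norm (x - v i) <= r) ->
  covering_ratios #|I| (@crosspolytope R d) r.
Proof.
move=> r0 vr vS; split=> //; exists (fun i => v (enum_val i)) => x Kx.
suff [i xi] : exists i, l1norm (x - v i) <= r.
  exists (enum_rank i) => //=; apply/mem_crosspolytope_translate => //.
  by rewrite enum_rankK.
have [->|x0] := eqVneq x 0; first by exists i0; rewrite sub0r l1normN.
set s := l1norm x; have s0 : s != 0 by rewrite l1norm_eq0.
have s_gt0 : 0 < s by rewrite lt_neqAle eq_sym s0 l1norm_ge0.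
have s1 : s <= 1 by [].
have [|i xi] := vS (s^-1 *: x).
  by rewrite l1normZ gtr0_norm ?invr_gt0// mulVf.
(* [x] divides the segment from the origin to [x / s] in the ratio
   [s : 1 - s]. *)
exists i; have -> : x - v i = s *: (s^-1 *: x - v i) + (1 - s) *: - v i.
  rewrite scalerBr scalerA mulfV// scale1r scalerN scalerBl scale1r opprB.
  by rewrite addrA subrK.
apply: le_trans (l1normD _ _) _; rewrite !l1normZ l1normN.
rewrite (gtr0_norm s_gt0) ger0_norm ?subr_ge0//.
have := ler_wpM2l (ltW s_gt0) xi.
have : (1 - s) * l1norm (v i) <= (1 - s) * r.
  by apply: ler_wpM2l; rewrite ?subr_ge0.
lra.
Qed.

End L1Norm.

(** * The upper bound *)

Section SignedVectors.
Variables (R : realType) (d : nat).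
Implicit Types (x : 'rV[R]_d) (b : 'I_d -> bool) (a : 'I_d -> R).

Definition signed_row b a : 'rV[R]_d := \row_j ((-1) ^+ b j * a j).

Lemma l1norm_signed_row b a : (forall j, 0 <= a j) ->
  l1norm (signed_row b a) = \sum_j a j.
Proof.
move=> a0; apply: eq_bigr => j _.
by rewrite mxE normrM normr_sign mul1r ger0_norm.
Qed.

(** The signs of [b] matter only on the support of [a]; there they have to be
    those of [x], so that each coordinate of [x] moves towards zero without
    passing it. *)
Lemma l1dist_signed_row x b a : (forall j, 0 <= a j) ->
    (forall j, a j != 0 -> b j = (x 0 j < 0)) ->
    (forall j, a j <= `|x 0 j|) ->
  l1norm (x - signed_row b a) = l1norm x - \sum_j a j.
Proof.
move=> a0 bx ax; rewrite -(l1norm_signed_row b a0); apply: l1norm_shrink => j.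
rewrite !mxE normrM normr_sign mul1r (ger0_norm (a0 j)).
have [->|aj0] := eqVneq (a j) 0; first by rewrite mulr0 !subr0.
rewrite bx // {1}[x 0 j]numEsign -mulrBr normrM normr_sign mul1r ger0_norm //.
by rewrite subr_ge0.
Qed.

End SignedVectors.

Section UpperBound.
Variables (R : realType) (d : nat) (p q : 'I_d).
Hypotheses (d_ge3 : (3 <= d)%N) (pq : p != q).

Let t : R := 2 / (2 * d%:R - 1).

Let dR_ge3 : 3 <= d%:R :> R.
Proof. by rewrite (ler_nat R 3). Qed.

Let denom_gt0 : 0 < 2 * d%:R - 1 :> R.
Proof. by move: dR_ge3; lra. Qed.

Let t_gt0 : 0 < t.
Proof. by rewrite divr_gt0. Qed.

Let t_le_half : t <= 1 / 2.
Proof. by rewrite ler_pdivrMr//; move: dR_ge3; lra. Qed.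

Let dt : d%:R * t = 1 + t / 2.
Proof. by rewrite /t; field; rewrite gt_eqF. Qed.

Definition axis_weight (i j : 'I_d) : R := if j == i then t else 0.

Definition plane_weight (j : 'I_d) : R :=
  if (j == p) || (j == q) then t / 2 else 0.

(** The sum type counts the centres: [2 d] for the axes and 4 for the plane of
    the coordinates [p] and [q]. *)
Definition centre (k : 'I_d * bool + bool * bool) : 'rV[R]_d :=
  match k with
  | inl (i, b) => signed_row (fun=> b) (axis_weight i)
  | inr (b, c) => signed_row (fun j => if j == p then b else c) plane_weight
  end.

Let axis_weight_ge0 i j : 0 <= axis_weight i j.
Proof. by rewrite /axis_weight; case: eqP => // _; exact: ltW. Qed.

Let plane_weight_ge0 j : 0 <= plane_weight j.
Proof. by rewrite /plane_weight; case: orP => // _; move: t_gt0; lra. Qed.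

Lemma sum_axis_weight i : \sum_j axis_weight i j = t.
Proof.
rewrite (bigD1 i) //= big1 => [|j /negPf ji]; rewrite /axis_weight ?ji //.
by rewrite eqxx addr0.
Qed.

Lemma sum_plane_weight : \sum_j plane_weight j = t.
Proof.
rewrite (bigD1 p) //= (bigD1 q) /= 1?eq_sym // big1.
  by rewrite /plane_weight !eqxx orbT /=; field.
by move=> j /andP[/negPf jp /negPf jq]; rewrite /plane_weight jp jq.
Qed.

Lemma l1norm_centre k : l1norm (centre k) = t.
Proof.
case: k => [[i b]|[b c]]; rewrite /centre l1norm_signed_row //.
  exact: sum_axis_weight.
exact: sum_plane_weight.
Qed.

(** A unit vector with a coordinate of size at least [t] is served by an axis
    centre.  Otherwise all coordinates are at most [t] in size, which is so
    close to their average [1 / d] that each of them is also at least [t / 2];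
    the plane centre with the signs of the coordinates [p] and [q] then
    serves. *)
Lemma sphere_covered x :
  l1norm x = 1 -> exists k, l1norm (x - centre k) <= 1 - t.
Proof.
move=> x1.
have [[i ti]|small] := pselect (exists i, t <= `|x 0 i|).
  exists (inl (i, x 0 i < 0)).
  rewrite l1dist_signed_row // ?sum_axis_weight ?x1 // => j.
    by rewrite /axis_weight; case: (eqVneq j i) => [->|]; rewrite ?eqxx.
  by rewrite /axis_weight; case: (eqVneq j i) => [->|].
have {}small j : `|x 0 j| <= t.
  by rewrite leNgt; apply/negP => /ltW tj; apply: small; exists j.
have large i : t / 2 <= `|x 0 i|.
  have : \sum_(j | j != i) `|x 0 j| <= \sum_(j < d | j != i) t.
    by apply: ler_sum => j _.
  rewrite sumr_const cardC1 card_ord -subn1 mulrnBr; last first.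
    exact: ltnW (ltnW d_ge3).
  move: x1; rewrite /l1norm (bigD1 i) //= => x1.
  rewrite -[t *+ d]mulr_natl dt mulr1n; lra.
exists (inr (x 0 p < 0, x 0 q < 0)).
rewrite l1dist_signed_row // ?sum_plane_weight ?x1 // => j.
  rewrite /plane_weight; case: (eqVneq j p) => [->|_] //=.
  by case: (eqVneq j q) => [->|_] //=; rewrite eqxx.
by rewrite /plane_weight; case: ifP.
Qed.

Lemma covering_ratio_crosspolytope :
  covering_ratios (2 * d + 4) (@crosspolytope R d)
    ((2 * d%:R - 3) / (2 * d%:R - 1)).
Proof.
have -> : (2 * d%:R - 3) / (2 * d%:R - 1) = 1 - t.
  by rewrite /t; field; rewrite gt_eqF.
have -> : (2 * d + 4 = #|{: 'I_d * bool + bool * bool}|)%N.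
  by rewrite card_sum !card_prod card_ord card_bool mulnC.
apply: (covering_ratio_of_sphere (inr (true, true)) (v := centre)).
- by move: t_le_half; lra.
- by move=> k; rewrite l1norm_centre; move: t_le_half; lra.
- exact: sphere_covered.
Qed.

End UpperBound.

(** * Partitions of a finite sequence into few classes of near points *)

Section SmallPartitions.
Variables (T : eqType) (near : rel T).

(** The results are ordered by the class that receives [x], a new singleton
    class coming last.  New classes are only ever appended at the end, so that
    partitions that differ only by the order of their classes are explored once;
    the bound [k] on the number of classes is spent along the recursion. *)
Fixpoint insertions (k : nat) (x : T) (P : seq (seq T)) : seq (seq (seq T)) :=
  match k, P with
  | 0, _ => [::]
  | _.+1, [::] => [:: [:: [:: x]]]
  | k'.+1, B :: P' =>
      (if all (near x) B then [:: (x :: B) :: P'] else [::])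
        ++ [seq B :: Q | Q <- insertions k' x P']
  end.

Definition near_partitions (k : nat) (s : seq T) : seq (seq (seq T)) :=
  foldr (fun x Ps => flatten [seq insertions k x P | P <- Ps]) [:: [::]] s.

(** A map into a type with [k] elements sorts the points into at most [k]
    classes, its fibres.  The enumeration, which reads the points from the
    end of the list, finds this partition when [cs] lists the values in the
    order in which it meets them. *)
Section Fibres.
Variables (C : finType) (f : T -> C).

Definition fibres (cs : seq C) (s : seq T) : seq (seq T) :=
  [seq [seq y <- s | f y == c] | c <- cs].

Lemma fibres_insert_old k x s cs :
    (size cs <= k)%N -> uniq cs -> f x \in cs ->
    {in s, forall y, f x = f y -> near x y} ->
  fibres cs (x :: s) \in insertions k x (fibres cs s).
Proof.
move=> + + + xs; elim: cs k => [|c cs IH] [|k] //= cs_k /andP[c_cs cs_uniq].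
rewrite inE mem_cat eq_sym; case: (eqVneq c (f x)) => [cx _|cx /= fx_cs].
  apply/orP; left; rewrite ifT; last first.
    apply/allP => y; rewrite mem_filter cx => /andP[/eqP fy ys].
    exact: xs.
  rewrite inE; apply/eqP; congr cons; apply/eq_in_map => c' c'_cs.
  by rewrite /= -cx; case: eqP => // cc'; rewrite cc' c'_cs in c_cs.
by apply/orP; right; rewrite map_f // IH.
Qed.

Lemma fibres_insert_new k x s cs :
    (size cs < k)%N -> f x \notin cs -> {in s, forall y, f y \in cs} ->
  fibres (rcons cs (f x)) (x :: s) \in insertions k x (fibres cs s).
Proof.
move=> cs_k fx_cs scs.
(* The fibre of a value that has not occurred is empty, so that [x] forms its
   class alone. *)
have new : [seq y <- s | f y == f x] = [::].
  apply/eqP; rewrite -[_ == _]negbK -has_filter; apply/hasPn => y ys.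
  by apply: contra fx_cs => /eqP <-; exact: scs.
elim: cs k fx_cs cs_k {scs} => [|c cs IH] [|k] //=.
  by rewrite eqxx new inE.
rewrite inE negb_or => /andP[/negPf xc fx_cs] cs_k; rewrite mem_cat xc.
by apply/orP; right; rewrite map_f // IH.
Qed.

(** Adding one point to the list changes the partition into fibres by one
    insertion: into an existing class if its value has occurred, as a new class
    otherwise. *)
Lemma near_partitions_neq0 (s : seq T) :
    {in s &, forall x y, f x = f y -> near x y} ->
  near_partitions #|C| s != [::].
Proof.
move=> fs.
suff [cs [_ _ P]] : exists cs, [/\ uniq cs, {in s, forall y, f y \in cs} &
    fibres cs s \in near_partitions #|C| s].
  by case: (near_partitions _ _) P.
elim: s fs => [|x s IH] fs; first by exists [::].
have [y z ys zs|cs [cs_uniq scs P]] := IH.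
  by apply: fs; rewrite inE ?ys ?zs orbT.
have [fx_cs|fx_cs] := boolP (f x \in cs).
  exists cs; split=> // [y|].
    by rewrite inE => /predU1P[->//|]; exact: scs.
  apply/flattenP; exists (insertions #|C| x (fibres cs s)); first exact: map_f.
  apply: fibres_insert_old => //.
    by rewrite -(card_uniqP cs_uniq) max_card.
  by move=> y ys; apply: fs; rewrite inE ?eqxx ?ys ?orbT.
have rcs_uniq : uniq (rcons cs (f x)) by rewrite rcons_uniq fx_cs.
exists (rcons cs (f x)); split=> // [y|].
  rewrite inE mem_rcons inE => /predU1P[->|ys]; first by rewrite eqxx.
  by rewrite scs ?orbT.
apply/flattenP; exists (insertions #|C| x (fibres cs s)); first exact: map_f.
apply: fibres_insert_new => //.
by rewrite -(size_rcons cs (f x)) -(card_uniqP rcs_uniq) max_card.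
Qed.

End Fibres.
End SmallPartitions.

(** * The lower bound in dimension four *)

Definition lattice_dist (x y : seq int) : nat :=
  sumn [seq `|(z.1 - z.2)%R|%N | z <- zip x y].

Section LatticePoints.
Variables (R : realType) (d : nat).

Definition lattice_point (n : nat) (z : seq int) : 'rV[R]_d :=
  \row_i ((z`_i)%:~R / n%:R).

Lemma l1dist_lattice_point n x y : size x = d -> size y = d ->
  l1norm (lattice_point n x - lattice_point n y) = (lattice_dist x y)%:R / n%:R.
Proof.
move=> xd yd; rewrite /lattice_dist sumnE big_map (big_nth (0, 0)) size_zip.
rewrite xd yd minnn big_mkord natr_sum mulr_suml; apply: eq_bigr => i _.
rewrite !mxE -mulrBl normrM normfV normr_nat nth_zip ?xd ?yd //=.
by rewrite -intrB -intr_norm natr_absz.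
Qed.

End LatticePoints.

(** Numerators over 7 of twelve points of which any two are at distance at least
    [10 / 7].  [near_partitions] starts from the end of its list, so these
    points come last in [test_points]: they take one class each, and only the
    placing of the ten others branches. *)
Definition far_points : seq (seq int) := [::
  [:: -2; 2; 1; 2]; [:: 2; -1; -2; 2]; [:: -2; -2; -1; -2];
  [:: 2; 1; 2; -2]; [:: 7; 0; 0; 0]; [:: -7; 0; 0; 0];
  [:: 0; 7; 0; 0]; [:: 0; -7; 0; 0]; [:: 0; 0; 7; 0];
  [:: 0; 0; -7; 0]; [:: 0; 0; 0; 7]; [:: 0; 0; 0; -7]].

Definition other_points : seq (seq int) := [::
  [:: 1; -2; 2; 2]; [:: -2; -2; 2; -1]; [:: 2; 2; 1; -2];
  [:: -2; 2; -1; 2]; [:: 2; 1; -2; -2]; [:: -2; -2; 2; 1];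
  [:: 1; 2; 2; 2]; [:: -2; 2; -2; -1]; [:: 2; -2; -2; 1];
  [:: -1; -2; 2; -2]].

Definition test_points := other_points ++ far_points.

(** Two points of one translate of ratio below [5 / 7] are at distance below
    [10 / 7]; for numerators over 7 the bound is 10. *)
Definition close (x y : seq int) := (lattice_dist x y < 10)%N.

Lemma test_points_in_crosspolytope :
  all (fun z => (size z == 4%N) && (lattice_dist z (nseq 4 0%R) <= 7)%N)
    test_points.
Proof. by vm_compute. Qed.

Lemma no_small_partition : near_partitions close 12 test_points = [::].
Proof. by vm_compute. Qed.

Lemma covering_ratio_ge (R : realType) (r : R) :
  covering_ratios 12 (@crosspolytope R 4) r -> 5 / 7 <= r.
Proof.
move=> [r0 [u cov]]; rewrite leNgt; apply/negP => r_lt.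
(* The choice of a translate for each test point; the default [ord0] serves
   the other lists of integers. *)
have sel z : exists i, z \in test_points ->
    l1norm (lattice_point R 4 7 z - u i) <= r.
  have [zT|_] := boolP (z \in test_points); last by exists ord0.
  have /andP[/eqP z4 z7] := allP test_points_in_crosspolytope z zT.
  have [|i _ /mem_crosspolytope_translate] := cov (lattice_point R 4 7 z).
    have -> : lattice_point R 4 7 z =
        lattice_point R 4 7 z - lattice_point R 4 7 (nseq 4 0).
      by apply/rowP => i; rewrite !mxE nth_nseq if_same mul0r subr0.
    change (l1norm (lattice_point R 4 7 z - lattice_point R 4 7 (nseq 4 0))
              <= 1).
    by rewrite l1dist_lattice_point // ler_pdivrMr// mul1r ler_nat.
  by move=> /(_ r0) zi; exists i.
have [f fP] := choice sel.
suff fclose : {in test_points &, forall x y, f x = f y -> close x y}.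
  by have := near_partitions_neq0 fclose; rewrite card_ord no_small_partition.
move=> x y xT yT fxy.
have /andP[/eqP x4 _] := allP test_points_in_crosspolytope x xT.
have /andP[/eqP y4 _] := allP test_points_in_crosspolytope y yT.
have := l1dist_triangle (u (f x))
  (lattice_point R 4 7 x) (lattice_point R 4 7 y).
rewrite l1dist_lattice_point // {2}fxy /close -(ltr_nat R).
have := fP x xT; have := fP y yT; lra.
Qed.

Theorem theorem5 (R : realType) (d m : nat) (hm : m = (2 * d + 4)%N) :
  (d = 4%N ->
    gamma m (@crosspolytope R d) = (2 * d%:R - 3) / (2 * d%:R - 1)) /\
  ((5 <= d)%N ->
    gamma m (@crosspolytope R d) <= (2 * d%:R - 3) / (2 * d%:R - 1)).
Proof.
rewrite {m}hm.
have ub : (4 <= d)%N ->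
    gamma (2 * d + 4) (@crosspolytope R d) <= (2 * d%:R - 3) / (2 * d%:R - 1).
  case: d => [|[|n]] // n4.
  apply: ge_inf; first by exists 0; exact: covering_ratios_lb.
  apply: (@covering_ratio_crosspolytope _ _ ord0 ord_max) => //.
  exact: ltnW.
split=> [d4|/ltnW]; last exact: ub.
rewrite {d}d4 in ub *; apply/eqP; rewrite eq_le ub //=.
have -> : (2 * 4 - 3) / (2 * 4 - 1) = 5 / 7 :> R by congr (_ / _); ring.
apply: lb_le_inf; first exact: covering_ratios_neq0.
by move=> r; exact: covering_ratio_ge.
Qed.
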